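(* Let $\mathcal{G}=(\mathcal{V},\mathcal{E},\mathbf{W})$ be a connected signed weighted undirected graph with Laplacian $L$. If $L$ is positive semi-definite with only one zero eigenvalue, then for all $i,j\in\mathcal{V}$ with $i\neq j$, $$r_{\mathrm{eff}}(L,\{i\},\{j\})=\mathcal{R}_{ij}\quad\text{and}\quad g_{\mathrm{eff}}(L,\{i\},\{j\})=\mathcal{C}_{ij},$$ where $\mathcal{R}_{ij}=(\mathbf{e}_i-\mathbf{e}_j)^TL^{\dagger}(\mathbf{e}_i-\mathbf{e}_j)$ and $\mathcal{C}_{ij}=1/\mathcal{R}_{ij}$ are the traditional effective resistance and effective conductance between $i$ and $j$.
   Context: Graph: $\mathcal{G}=(\mathcal{V},\mathcal{E},\mathbf{W})$ is a simple undirected connected graph with finite node set $\mathcal{V}$, $n=|\mathcal{V}|$, edge set $\mathcal{E}$, $l=|\mathcal{E}|$; each edge $(i,j)$ carries a nonzero real weight $w_{ij}$, positive or negative, and $\mathbf{W}\in\mathbb{R}^{l\times l}$ is the diagonal matrix of edge weights. With the edges arbitrarily oriented, $\mathbf{E}\in\mathbb{R}^{n\times l}$ is the incidence matrix (column of an edge from $i$ to $j$: entry $1$ in row $i$, $-1$ in row $j$, $0$ elsewhere). The Laplacian is $L=\mathbf{E}\mathbf{W}\mathbf{E}^T$ (real symmetric with zero row sums). ''Positive semi-definite with only one zero eigenvalue'' means $L\succeq 0$ and $0$ is a simple eigenvalue. $L^{\dagger}$ is the Moore–Penrose inverse of $L$; $\mathbf{e}_i\in\mathbb{R}^n$ is the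 $i$-th standard basis vector. Effective resistance/conductance: for non-empty disjoint $\mathcal{V}_a,\mathcal{V}_b\subset\mathcal{V}$ put $\mathcal{V}_c=\mathcal{V}\setminus(\mathcal{V}_a\cup\mathcal{V}_b)$, $a=|\mathcal{V}_a|$, $b=|\mathcal{V}_b|$, and let $L_{xy}$ be the submatrix of $L$ with rows indexed by $\mathcal{V}_x$ and columns by $\mathcal{V}_y$. When $L_{cc}$ is nonsingular (which is automatic if $L$ is positive semi-definite with only one zero eigenvalue), let $L/L_{cc}$ be the Schur complement $$L/L_{cc}=\begin{bmatrix}L_{aa}&L_{ab}\\L_{ab}^T&L_{bb}\end{bmatrix}-\begin{bmatrix}L_{ac}\\L_{bc}\end{bmatrix}L_{cc}^{-1}\begin{bmatrix}L_{ac}^T&L_{bc}^T\end{bmatrix},$$ with $L/L_{cc}=L$ if $\mathcal{V}_c=\emptyset$. Then $g_{\mathrm{eff}}(L,\mathcal{V}_a,\mathcal{V}_b)=\mathbf{e}_{\mathcal{V}_a}^T(L/L_{cc})\mathbf{e}_{\mathcal{V}_a}$, where $\mathbf{e}_{\mathcal{V}_a}\in\mathbb{R}^{a+b}$ has entries $1$ on $\mathcal{V}_a$ and $0$ on $\mathcal{V}_b$, and $r_{\mathrm{eff}}(L,\mathcal{V}_a,\mathcal{V}_b)=g_{\mathrm{eff}}(L,\mathcal{V}_a,\mathcal{V}_b)^{-1}$ (with $r_{\mathrm{eff}}=\infty$ if $g_{\mathrm{eff}}=0$). *)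

(* Defs.v *)
From HB Require Import structures.
From mathcomp Require Import all_boot all_order all_algebra.
From mathcomp Require Import constructive_ereal reals.

Set Implicit Arguments.
Unset Strict Implicit.
Unset Printing Implicit Defensive.

Import Order.TTheory GRing.Theory Num.Theory.
Local Open Scope ring_scope.

(* Simple undirected graphs on the node set 'I_n with nonzero real edge
   weights of either sign; only the values of [weight] on [edges] matter. *)
Record signed_graph (R : realFieldType) (n : nat) := SignedGraph {
  edges : {set {set 'I_n}};
  weight : {set 'I_n} -> R;
  card_edge : forall e, e \in edges -> #|e| = 2%N;
  weight_neq0 : forall e, e \in edges -> weight e != 0
}.

(* An arbitrary orientation; the edges are numbered by [enum_val]. *)
Record orientation (R : realFieldType) (n : nat) (G : signed_graph R n) :=
  Orientation {
    etail : 'I_#|edges G| -> 'I_n;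
    ehead : 'I_#|edges G| -> 'I_n;
    ends_edge : forall k, [set etail k; ehead k] = enum_val k
  }.

Section Graph.
Variables (R : realFieldType) (n : nat) (G : signed_graph R n).

Definition adj : rel 'I_n := fun u v => [set u; v] \in edges G.

Definition connected_graph : Prop := forall u v : 'I_n, connect adj u v.

Definition incidence_mx (o : orientation G) : 'M[R]_(n, #|edges G|) :=
  \matrix_(v, k) (if v == etail o k then 1
                  else if v == ehead o k then -1 else 0).

Definition weight_mx : 'M[R]_#|edges G| :=
  diag_mx (\row_k weight G (enum_val k)).

Definition laplacian (o : orientation G) : 'M[R]_n :=
  incidence_mx o *m weight_mx *m (incidence_mx o)^T.

End Graph.

Section Matrices.
Variable R : realFieldType.

Definition psd n (A : 'M[R]_n) : Prop :=
  A^T = A /\ forall x : 'cV[R]_n, 0 <= (x^T *m A *m x) 0 0.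

Definition simple_eigenvalue n (A : 'M[R]_n) (a : R) : Prop :=
  mup a (char_poly A) = 1%N.

Definition penrose m n (A : 'M[R]_(m, n)) (X : 'M[R]_(n, m)) : bool :=
  [&& A *m X *m A == A, X *m A *m X == X,
      (A *m X)^T == A *m X & (X *m A)^T == X *m A].

Lemma gram_unit m n (A : 'M[R]_(m, n)) : row_free A -> A *m A^T \in unitmx.
Proof.
move=> fA; rewrite -row_free_unit -kermx_eq0; apply/rowV0P => u.
move=> /sub_kermxP uK.
have uA0 : u *m A = 0.
  have : (u *m A) *m (u *m A)^T = 0.
    by rewrite trmx_mul mulmxA -(mulmxA u) uK mul0mx.
  move/matrixP/(_ 0 0); rewrite !mxE => s0.
  apply/rowP => k; rewrite [RHS]mxE; apply/eqP.
  have sq (j : 'I_n) : true -> 0 <= (u *m A) 0 j * (u *m A)^T j 0.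
    by rewrite [_^T _ _]mxE -expr2 sqr_ge0.
  have /eqP := psumr_eq0P sq s0 (i := k) isT.
  by rewrite [_^T _ _]mxE mulf_eq0 orbb.
by apply: (row_free_inj fA); rewrite uA0 mul0mx.
Qed.

Lemma penrose_mul m r n (B : 'M[R]_(m, r)) (C : 'M[R]_(r, n)) :
  B^T *m B \in unitmx -> C *m C^T \in unitmx ->
  penrose (B *m C)
    (C^T *m invmx (C *m C^T) *m invmx (B^T *m B) *m B^T).
Proof.
move=> uB uC; set X := (X in penrose _ X).
have AX : B *m C *m X = B *m invmx (B^T *m B) *m B^T.
  rewrite /X !mulmxA -(mulmxA B C C^T) -(mulmxA B (C *m C^T)) mulmxV //.
  by rewrite mulmx1.
have XA : X *m (B *m C) = C^T *m invmx (C *m C^T) *m C.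
  rewrite /X !mulmxA -(mulmxA _ B^T B).
  by rewrite -(mulmxA _ (invmx (B^T *m B))) mulVmx // mulmx1.
apply/and4P; split; apply/eqP.
- rewrite AX !mulmxA -(mulmxA _ B^T B) -(mulmxA B (invmx _)) mulVmx //.
  by rewrite mulmx1.
- rewrite XA /X !mulmxA -(mulmxA _ C C^T).
  by rewrite -(mulmxA C^T (invmx _) (C *m C^T)) mulVmx // mulmx1.
- by rewrite AX !trmx_mul trmxK trmx_inv trmx_mul trmxK mulmxA.
- by rewrite XA !trmx_mul trmxK trmx_inv trmx_mul trmxK mulmxA.
Qed.

Lemma penrose_ex m n (A : 'M[R]_(m, n)) : exists X, penrose A X.
Proof.
have uC : row_base A *m (row_base A)^T \in unitmx.
  by apply: gram_unit; apply: row_base_free.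
have uB : (col_base A)^T *m col_base A \in unitmx.
  have := @gram_unit _ _ (col_base A)^T; rewrite trmxK; apply.
  by rewrite /row_free mxrank_tr; exact: (col_base_full A).
by have := penrose_mul uB uC; rewrite mulmx_base => pA; eexists; exact: pA.
Qed.

Lemma penrose_uniq m n (A : 'M[R]_(m, n)) X Y :
  penrose A X -> penrose A Y -> X = Y.
Proof.
move=> /and4P[/eqP x1 /eqP x2 /eqP x3 /eqP x4].
move=> /and4P[/eqP y1 /eqP y2 /eqP y3 /eqP y4].
have AXY : A *m X = A *m Y.
  by rewrite -x3 -[in LHS]y1 -mulmxA trmx_mul x3 y3 !mulmxA x1.
have XYA : X *m A = Y *m A.
  rewrite -x4 -[in LHS]y1 -mulmxA [X *m _]mulmxA trmx_mul.
  by rewrite y4 x4 -mulmxA [A *m _]mulmxA x1.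
by rewrite -x2 XYA -mulmxA AXY mulmxA y2.
Qed.

Definition mpinv m n (A : 'M[R]_(m, n)) : 'M[R]_(n, m) :=
  xchoose (penrose_ex A).

Lemma mpinvP m n (A : 'M[R]_(m, n)) : penrose A (mpinv A).
Proof. exact: xchooseP. Qed.

End Matrices.

Section Effective.
Variables (R : realFieldType) (n : nat) (L : 'M[R]_n).

Definition subm (A B : {set 'I_n}) : 'M[R]_(#|A|, #|B|) :=
  mxsub (fun k : 'I_#|A| => enum_val k) (fun k : 'I_#|B| => enum_val k) L.

(* L / L_cc with c the complement of a and b, rows and columns listing the
   nodes of a, then those of b. It is meaningful when L_cc is nonsingular
   (invmx is the identity function on singular matrices). If c is empty, the
   second term is a product through dimension 0, hence 0. *)
Definition schur_compl (a b : {set 'I_n}) : 'M[R]_(#|a| + #|b|) :=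
  let c := ~: (a :|: b) in
  block_mx (subm a a) (subm a b) (subm a b)^T (subm b b)
  - col_mx (subm a c) (subm b c) *m invmx (subm c c)
    *m row_mx (subm a c)^T (subm b c)^T.

Definition g_eff (a b : {set 'I_n}) : R :=
  let e : 'cV[R]_(#|a| + #|b|) := col_mx (const_mx 1) (const_mx 0) in
  (e^T *m schur_compl a b *m e) 0 0.

(* The inverse of extended reals, for which 0^-1 = +oo. *)
Definition r_eff (a b : {set 'I_n}) : \bar R := ((g_eff a b)%:E^-1)%E.

Definition resistance (i j : 'I_n) : R :=
  let d : 'cV[R]_n := delta_mx i 0 - delta_mx j 0 in
  (d^T *m mpinv L *m d) 0 0.

Definition conductance (i j : 'I_n) : R := 1 / resistance i j.

End Effective.

(* Main.v *)
Require Import Defs.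
From HB Require Import structures.
From mathcomp Require Import all_boot all_order all_algebra.
From mathcomp Require Import constructive_ereal reals.
From mathcomp Require Import lra.

(** Ground node j and hold node i at potential 1. The potential x that these
    two values force on all nodes is harmonic off {i, j}: its values on the
    remaining nodes c solve [L_cc x_c = - L_ci], so that [L x] vanishes on c.
    The Schur complement then expresses nothing but the current entering at i,
    that is [(L x)_i = g_eff] ([g_eff_potential]). The columns of L sum to 0, so
    the same current leaves at j and [L x = g_eff (e_i - e_j)].

    Pairing this with [(e_i - e_j)^T L^+] gives

      [g_eff * R_ij = (e_i - e_j)^T L^+ L x = (e_i - e_j)^T x = 1 - 0],

    because [L^+ L] is the identity up to vectors of ker L, which is spanned by
    the all-ones vector and hence orthogonal to [e_i - e_j]
    ([mpinv_mul_sum0]). Both equalities of the theorem follow, together with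
    [g_eff != 0], which keeps the resistance finite.

    The spectral hypotheses enter in two places. Simplicity of the eigenvalue 0
    is algebraic, and ker L is a line because the geometric multiplicity is at
    most the algebraic one ([dvdp_char_poly_corank]). Positivity makes [L_cc]
    nonsingular: a kernel vector of [L_cc], extended by 0, annihilates the
    quadratic form of L, so it lies in ker L, is constant, and is thus 0
    ([subm_unit]). *)

Set Implicit Arguments.
Unset Strict Implicit.
Unset Printing Implicit Defensive.

Import Order.TTheory GRing.Theory Num.Theory.
Local Open Scope ring_scope.

(** * Isotropic vectors of semidefinite forms *)

Lemma quad_formE (R : realFieldType) n (A : 'M[R]_n) (x y : 'cV[R]_n) (t : R) :
  A^T = A ->
  ((x - t *: y)^T *m A *m (x - t *: y)) 0 0 =
  (x^T *m A *m x) 0 0 - 2 * t * (y^T *m A *m x) 0 0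
  + t ^+ 2 * (y^T *m A *m y) 0 0.
Proof.
move=> symA.
have xAy : (x^T *m A *m y) 0 0 = (y^T *m A *m x) 0 0.
  rewrite -[in RHS](trmxK x) -[in RHS]symA -mulmxA.
  by rewrite -[in RHS]trmx_mul -trmx_mul [RHS]mxE.
have -> : (x - t *: y)^T = x^T - t *: y^T by rewrite linearB linearZ.
rewrite !mulmxBl !mulmxBr -!scalemxAl -!scalemxAr scalerA.
move: (x^T *m A *m x) (x^T *m A *m y) (y^T *m A *m x) (y^T *m A *m y) xAy.
by move=> a b c d bE; rewrite !mxE bE; lra.
Qed.

(** With z = A x, the form at x - t z is - 2 t |z|^2 + t^2 z^T A z, which is
    negative for small t > 0 unless z = 0. *)
Lemma psd_quad_eq0 (R : realFieldType) n (A : 'M[R]_n) (x : 'cV[R]_n) :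
  psd A -> (x^T *m A *m x) 0 0 = 0 -> A *m x = 0.
Proof.
move=> [symA posA] xAx0.
set z := A *m x.
have zAx : (z^T *m A *m x) 0 0 = \sum_k (z k 0) ^+ 2.
  by rewrite -mulmxA -/z mxE; apply: eq_bigr => k _; rewrite mxE expr2.
set q := \sum_k _ in zAx.
have sq (k : 'I_n) : true -> 0 <= z k 0 ^+ 2 by rewrite sqr_ge0.
have q0 : 0 <= q by apply: sumr_ge0.
have qE : q = 0.
  set p := (z^T *m A *m z) 0 0.
  have p0 : 0 <= p by apply: posA.
  have p1 : p + 1 != 0 by rewrite gt_eqF // ltr_wpDl.
  (* If q > 0, any t > 0 with t p < 2 q gives a negative value; dividing by
     p + 1 instead of p covers p = 0. *)
  have := posA (x - (q / (p + 1)) *: z).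
  rewrite quad_formE // xAx0 zAx -/p.
  set t := q / (p + 1).
  have qt : q = t * (p + 1) by rewrite /t divfK.
  have t0 : 0 <= t by rewrite divr_ge0 // addr_ge0.
  rewrite qt => ineq.
  have : t ^+ 2 * (p + 2) <= 0 by lra.
  rewrite pmulr_lle0 ?ltr_wpDl // => t2.
  have /eqP : t ^+ 2 == 0 by rewrite eq_le t2 sqr_ge0.
  by move/eqP; rewrite sqrf_eq0 => /eqP ->; rewrite mul0r.
apply/colP => k; rewrite [RHS]mxE.
have /eqP := psumr_eq0P sq qE (i := k) isT.
by rewrite sqrf_eq0 => /eqP.
Qed.

(** * The kernel at a simple zero eigenvalue *)

(** The geometric multiplicity of 0 is at most the algebraic one. An invertible
    C brings A to a matrix C A whose last n - r rows vanish, so these rows of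
    C (X - A) are those of X C: each contributes a factor X to the
    determinant. *)
Lemma dvdp_char_poly_corank (F : fieldType) n (A : 'M[F]_n) :
  'X^(n - \rank A) %| char_poly A.
Proof.
set r := \rank A.
pose C := invmx (col_ebase A).
have CA (i j : 'I_n) : ~~ (i < r)%N -> (C *m A) i j = 0.
  move=> ir; rewrite /C -[in X in _ *m X](mulmx_ebase A) !mulmxA.
  rewrite mulVmx ?col_ebase_unit // mul1mx mxE big1 // => k _.
  by rewrite mxE (negPf ir) andbF mul0r.
pose D : 'rV[{poly F}]_n := \row_i (if (i < r)%N then 1 else 'X).
pose M := map_mx polyC C *m char_poly_mx A.
pose N := \matrix_(i, j) (if (i < r)%N then M i j else (C i j)%:P).
have MX (i j : 'I_n) : ~~ (i < r)%N -> M i j = 'X * (C i j)%:P.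
  move=> ir; rewrite /M /char_poly_mx mulmxBr -map_mxM scalar_mxC mul_scalar_mx.
  rewrite mxE [X in _ + X]mxE [X in - X]mxE CA // oppr0 addr0.
  by rewrite mxE [X in _ * X]mxE.
have ME : M = diag_mx D *m N.
  apply/matrixP => i j; rewrite mul_diag_mx [RHS]mxE [D _ _]mxE [N _ _]mxE.
  by case: ifPn => [_|/MX//]; rewrite mul1r.
have detM : (\det C)%:P * char_poly A = (\prod_i D 0 i) * \det N.
  by rewrite -det_map_mx -det_mulmx -/M ME det_mulmx det_diag.
have Cn0 : \det C != 0.
  by rewrite -unitfE -unitmxE unitmx_inv col_ebase_unit.
have -> : ('X^(n - r) %| char_poly A) =
          ('X^(n - r) %| (\det C)%:P * char_poly A).
  by rewrite mul_polyC dvdpZr.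
rewrite detM dvdp_mulr //.
have -> : \prod_i D 0 i = 'X^(n - r).
  rewrite (eq_bigr (fun i : 'I_n => if (i < r)%N then 1 else 'X)); last first.
    by move=> i _; rewrite mxE.
  rewrite -(big_mkord xpredT (fun i => if (i < r)%N then 1 else 'X : {poly F})).
  rewrite (big_cat_nat _ (n := r)) ?rank_leq_row //=.
  rewrite big_nat big1 => [|i /andP[_ ->] //]; rewrite mul1r.
  rewrite big_nat (eq_bigr (fun=> 'X)) => [|i /andP[ri _]]; last by rewrite ltnNge ri.
  by rewrite -big_nat prodr_const_nat.
exact: dvdpp.
Qed.

Lemma simple_eigenvalue0_ker (R : realFieldType) n (A : 'M[R]_n) :
  simple_eigenvalue A 0 -> A^T = A -> A *m (const_mx 1 : 'cV_n) = 0 ->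
  forall x : 'cV_n, A *m x = 0 -> exists c, x = const_mx c.
Proof.
move=> simpleA symA A1 x Ax.
have ker_row (y : 'cV_n) : A *m y = 0 -> (y^T <= kermx A)%MS.
  by move=> Ay; apply/sub_kermxP; rewrite -[in LHS]symA -trmx_mul Ay trmx0.
have rk1 : (\rank (kermx A) <= 1)%N.
  rewrite mxrank_ker -simpleA mup_geq ?monic_neq0 ?char_poly_monic //.
  by rewrite subr0 dvdp_char_poly_corank.
have [n0|n0] := posnP n.
  by exists 0; apply/colP => i; have := ltn_ord i; rewrite [X in (_ < X)%N]n0.
set one : 'cV[R]_n := const_mx 1 in A1.
have one0 : one^T != 0.
  apply/eqP => /rowP/(_ (Ordinal n0)); rewrite !mxE => /eqP.
  by rewrite oner_eq0.
have : (x^T <= one^T)%MS.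
  apply: (submx_trans (ker_row _ Ax)).
  have le1 := ker_row _ A1.
  by rewrite -(geq_leqif (mxrank_leqif_sup le1)) rank_rV one0.
case/sub_rVP => c xE; exists c.
by rewrite -[x]trmxK xE; apply/colP => i; rewrite !mxE mulr1.
Qed.

(** * Extension by zero from a set of nodes *)

Section Select.
Variables (R : realFieldType) (n : nat).
Implicit Types A B a b : {set 'I_n}.

(** Multiplication by [select A] extends by 0 a vector indexed by A, and
    multiplication by its transpose restricts to A; writing submatrices this way
    turns identities on blocks of L into plain associativity. *)
Definition select A : 'M[R]_(n, #|A|) := \matrix_(v, k) (v == enum_val k)%:R.

Lemma tr_select_mul A m (M : 'M[R]_(n, m)) k l :
  ((select A)^T *m M) k l = M (enum_val k) l.
Proof.
rewrite mxE (bigD1 (enum_val k)) //= !mxE eqxx mul1r big1 ?addr0 // => v vk.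
by rewrite !mxE (negPf vk) mul0r.
Qed.

Lemma mul_select A m (M : 'M[R]_(m, n)) k l :
  (M *m select A) k l = M k (enum_val l).
Proof.
by rewrite -[M in LHS]trmxK -[select A]trmxK -trmx_mul mxE tr_select_mul mxE.
Qed.

Lemma submE L A B : subm L A B = (select A)^T *m L *m select B.
Proof. by apply/matrixP => k l; rewrite mul_select tr_select_mul mxE. Qed.

Lemma select_in A m (M : 'M[R]_(#|A|, m)) v l (vA : v \in A) :
  (select A *m M) v l = M (enum_rank_in vA v) l.
Proof.
rewrite mxE (bigD1 (enum_rank_in vA v)) //= mxE enum_rankK_in // eqxx mul1r.
rewrite big1 ?addr0 // => k kv; rewrite mxE; case: eqP => [vk|_]; last exact: mul0r.
by case/eqP: kv; apply: enum_val_inj; rewrite enum_rankK_in.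
Qed.

Lemma select_notin A m (M : 'M[R]_(#|A|, m)) v l :
  v \notin A -> (select A *m M) v l = 0.
Proof.
move=> vA; rewrite mxE big1 // => k _; rewrite mxE.
by case: eqP => [vk|_]; [rewrite vk enum_valP in vA | exact: mul0r].
Qed.

Lemma tr_select_select A : (select A)^T *m select A = 1%:M.
Proof.
apply/matrixP => k l; rewrite tr_select_mul !mxE.
by rewrite (inj_eq enum_val_inj).
Qed.

Lemma select_set1 i : select [set i] *m const_mx 1 = delta_mx i 0 :> 'cV[R]_n.
Proof.
apply/colP => v; rewrite [RHS]mxE eqxx andbT; have [->|vi] := eqVneq v i.
  by rewrite select_in ?set11 // => vA; rewrite mxE.
by rewrite select_notin // inE.
Qed.

End Select.

(** * Node potentials and the Schur complement *)

(** A vector supported on c and isotropic for L lies in the kernel of L, so it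
    is constant; it vanishes at a node outside c, hence everywhere. *)
Lemma subm_unit (R : realFieldType) n (L : 'M[R]_n) (c : {set 'I_n}) :
  psd L -> (forall x : 'cV_n, L *m x = 0 -> exists a, x = const_mx a) ->
  c != setT -> subm L c c \in unitmx.
Proof.
move=> psdL kerL cT; rewrite -row_free_unit -kermx_eq0; apply/rowV0P => u.
move=> /sub_kermxP uL; rewrite submE in uL.
have [a xE] : exists a, select R c *m u^T = const_mx a.
  apply: kerL; apply: psd_quad_eq0 => //.
  rewrite trmx_mul trmxK; rewrite !mulmxA in uL *.
  by rewrite uL mul0mx mxE.
have [v vc] : exists v, v \notin c.
  apply/existsP; apply: contraNT cT; rewrite negb_exists => /forallP cT.
  by apply/eqP/setP => v; rewrite inE; apply/negPn.
have a0 : a = 0.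
  by have /colP/(_ v) := xE; rewrite select_notin // mxE.
rewrite -[u]trmxK -[u^T]mul1mx -tr_select_select -mulmxA xE a0.
by rewrite mulmx0 trmx0.
Qed.

Section Potential.
Variables (R : realFieldType) (n : nat) (L : 'M[R]_n) (a b : {set 'I_n}).
Let c := ~: (a :|: b).

(** The potential that is 1 on a, 0 on b, and balanced on c, where c carries
    no external current. *)
Definition potential : 'cV[R]_n :=
  select R a *m const_mx 1
  - select R c *m (invmx (subm L c c) *m subm L c a *m const_mx 1).

Lemma tr_subm (A B : {set 'I_n}) : L^T = L -> (subm L A B)^T = subm L B A.
Proof. by move=> symL; rewrite !submE !trmx_mul trmxK symL mulmxA. Qed.

Lemma potential_harmonic v : subm L c c \in unitmx -> v \in c ->
  (L *m potential) v 0 = 0.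
Proof.
move=> uL vc.
have bal : (select R c)^T *m (L *m potential) = 0.
  rewrite /potential !mulmxBr !mulmxA -!submE.
  by rewrite mulmxV // mul1mx subrr.
have := tr_select_mul (L *m potential) (enum_rank_in vc v) 0.
by rewrite bal mxE enum_rankK_in.
Qed.

(** Eliminating c from the equations of the network leaves the response of a and
    b, so the quadratic form of the Schur complement is the total current
    entering through a. *)
Lemma g_eff_potential : L^T = L ->
  g_eff L a b = ((select R a *m (const_mx 1 : 'cV_#|a|))^T *m L *m potential) 0 0.
Proof.
move=> symL; rewrite /g_eff /schur_compl -/c tr_col_mx mulmxBr mulmxBl.
rewrite mul_row_block mul_row_col !mulmxA mul_row_col -!mulmxA mul_row_col.
rewrite !trmx_const (_ : const_mx 0 = 0 :> 'rV[R]_#|b|) //.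
rewrite (_ : const_mx 0 = 0 :> 'cV[R]_#|b|) //.
rewrite !mul0mx !mulmx0 !addr0 (tr_subm _ _ symL) /potential trmx_mul !mulmxBr.
by rewrite trmx_const !submE !mulmxA.
Qed.

End Potential.

(** * Resistance through the pseudo-inverse *)

(** The columns of 1 - L^+ L lie in ker L, as L L^+ L = L; they are thus constant
    vectors, which d annihilates. *)
Lemma mpinv_mul_sum0 (R : realFieldType) n (L : 'M[R]_n) (d : 'cV[R]_n) :
  (forall x : 'cV_n, L *m x = 0 -> exists c, x = const_mx c) ->
  d^T *m (const_mx 1 : 'cV_n) = 0 -> d^T *m mpinv L *m L = d^T.
Proof.
move=> kerL d1.
suff dP : d^T *m (1%:M - mpinv L *m L) = 0.
  by apply/esym/eqP; rewrite -subr_eq0 -mulmxA -[X in X - _]mulmx1 -mulmxBr dP.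
apply/matrixP => k l.
have [r rE] : exists r, col l (1%:M - mpinv L *m L) = const_mx r.
  apply: kerL; rewrite colE mulmxA mulmxBr mulmx1 mulmxA.
  have /and4P[/eqP -> _ _ _] := mpinvP L.
  by rewrite subrr mul0mx.
have -> : (d^T *m (1%:M - mpinv L *m L)) k l =
          (d^T *m col l (1%:M - mpinv L *m L)) k 0.
  by rewrite colE mulmxA -colE [RHS]mxE.
rewrite rE (_ : const_mx r = r *: const_mx 1) -?scalemxAr ?d1 ?scaler0 ?mxE //.
by apply/colP => v; rewrite !mxE mulr1.
Qed.

(** The potential x satisfies L x = g (e_i - e_j), and its drop from i to j
    is 1. *)
Lemma g_eff_resistance (R : realFieldType) n (L : 'M[R]_n) (i j : 'I_n) :
  psd L -> L *m (const_mx 1 : 'cV_n) = 0 ->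
  (forall x : 'cV_n, L *m x = 0 -> exists c, x = const_mx c) ->
  i != j -> g_eff L [set i] [set j] * resistance L i j = 1.
Proof.
move=> psdL L1 kerL ij; have symL : L^T = L by case: psdL.
set c := ~: ([set i] :|: [set j]).
have ic : i \notin c by rewrite !inE eqxx.
have jc : j \notin c by rewrite !inE eqxx orbT.
have uL : subm L c c \in unitmx.
  by apply: subm_unit => //; apply: contraNneq ic => ->; rewrite inE.
set x := potential L [set i] [set j].
have x_boundary v : v \notin c -> x v 0 = (v == i)%:R.
  move=> vc; rewrite /x /potential select_set1 mxE [X in _ + X]mxE.
  by rewrite select_notin // subr0 mxE eqxx andbT.
set g := g_eff L [set i] [set j].
pose d : 'cV[R]_n := delta_mx i 0 - delta_mx j 0.
have dM (y : 'cV[R]_n) : (d^T *m y) 0 0 = y i 0 - y j 0.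
  by rewrite /d linearB /= !trmx_delta mulmxBl -!rowE !mxE.
have Lx_i : (L *m x) i 0 = g.
  by rewrite /g g_eff_potential // select_set1 -mulmxA trmx_delta -rowE [RHS]mxE.
(* Kirchhoff: the currents entering the network sum to 0. *)
have sumLx : (L *m x) i 0 + (L *m x) j 0 = 0.
  have : ((L *m (const_mx 1 : 'cV_n))^T *m x) 0 0 = 0 by rewrite L1 trmx0 mul0mx mxE.
  rewrite trmx_mul symL -mulmxA mxE (bigD1 i) // (bigD1 j) 1?eq_sym //=.
  rewrite big1 => [|v /andP[vi vj]].
    by rewrite !mxE !mul1r addr0.
  by rewrite potential_harmonic ?mulr0 // !inE negb_or vi.
have Lx : L *m x = g *: d.
  apply/colP => v; rewrite [RHS]mxE [d _ _]mxE [X in _ + X]mxE ![delta_mx _ _ _ _]mxE.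
  rewrite eqxx !andbT.
  have [->|vi] := eqVneq v i; first by rewrite (negPf ij) subr0 mulr1.
  have [->|vj] := eqVneq v j; last first.
    by rewrite subrr mulr0 potential_harmonic // !inE negb_or vi.
  by rewrite sub0r mulrN1 -Lx_i; apply/eqP; rewrite -addr_eq0 addrC sumLx.
have d1 : d^T *m (const_mx 1 : 'cV_n) = 0.
  by apply/matrixP => k l; rewrite !ord1 dM !mxE subrr.
rewrite -/g /resistance -/d.
have -> : g * (d^T *m mpinv L *m d) 0 0 = (d^T *m mpinv L *m (g *: d)) 0 0.
  by rewrite -scalemxAr [RHS]mxE.
by rewrite -Lx mulmxA mpinv_mul_sum0 // dM !x_boundary // eqxx eq_sym (negPf ij) subr0.
Qed.

(** * The Laplacian *)

Lemma laplacian_mul1 (R : realFieldType) n (G : signed_graph R n)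
    (o : orientation G) : laplacian o *m (const_mx 1 : 'cV_n) = 0.
Proof.
suff E1 : (incidence_mx o)^T *m (const_mx 1 : 'cV_n) = 0.
  by rewrite /laplacian -mulmxA E1 mulmx0.
apply/colP => k; rewrite !mxE.
have htE : etail o k != ehead o k.
  have := card_edge (enum_valP k); rewrite -(ends_edge o) cards2.
  by case: eqP.
rewrite (bigD1 (etail o k)) // (bigD1 (ehead o k)) 1?eq_sym //= !mxE !eqxx.
rewrite eq_sym (negPf htE) !mulr1 big1 ?addr0 ?subrr // => v /andP[vt vh].
by rewrite !mxE (negPf vt) (negPf vh) mul0r.
Qed.

Unset Implicit Arguments.

Theorem corollary1 (R : realType) (n : nat) (G : signed_graph R n)
    (o : orientation G) :
  connected_graph G ->
  psd (laplacian o) ->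
  simple_eigenvalue (laplacian o) 0 ->
  forall i j : 'I_n, i != j ->
    r_eff (laplacian o) [set i] [set j] = (resistance (laplacian o) i j)%:E
    /\ g_eff (laplacian o) [set i] [set j] = conductance (laplacian o) i j.
Proof.
move=> _ psdL simpleL i j ij.
have L1 := laplacian_mul1 o.
have kerL := simple_eigenvalue0_ker simpleL (proj1 psdL) L1.
have gr := g_eff_resistance psdL L1 kerL ij.
have g0 : g_eff (laplacian o) [set i] [set j] != 0.
  by apply: contra_eq_neq gr => ->; rewrite mul0r eq_sym oner_neq0.
have r0 : resistance (laplacian o) i j != 0.
  by apply: contra_eq_neq gr => ->; rewrite mulr0 eq_sym oner_neq0.
split; last by rewrite /conductance -gr mulfK.
by rewrite /r_eff inver (negPf g0) -[_^-1]mulr1 -gr mulKf.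
Qed.
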